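(* Let $n \geq 2$. If $K \subseteq \mathbb{R}^n$ is a Besicovitch set, then $$\dim_{\mathrm H} K + \dim_{\mathrm P} K \geq n.$$
   Context: $\dim_{\mathrm H}$ and $\dim_{\mathrm P}$ denote Hausdorff and packing dimension, respectively. A subset of $\mathbb{R}^n$ (not necessarily Borel) is called a Besicovitch set if it contains a unit line segment in every direction. *)

(* Defs.v *)
From HB Require Import structures.
From mathcomp Require Import all_boot all_order all_algebra.
From mathcomp Require Import all_classical all_reals all_analysis.

Set Implicit Arguments.
Unset Strict Implicit.
Unset Printing Implicit Defensive.

Import Order.TTheory GRing.Theory Num.Theory.
Import numFieldNormedType.Exports.

Local Open Scope classical_set_scope.
Local Open Scope ring_scope.

Section Euclidean.
Context {R : realType} {n : nat}.

(* The library norm `|x| on 'rV[R]_n is the sup norm. *)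
Definition enorm (x : 'rV[R]_n) : R := Num.sqrt (\sum_i x ord0 i ^+ 2).

Definition ecball (x : 'rV[R]_n) (r : R) : set 'rV[R]_n :=
  [set y | enorm (y - x) <= r].

Definition ediam (A : set 'rV[R]_n) : \bar R :=
  maxe 0%E (ereal_sup [set (enorm (x - y))%:E | x in A & y in A]).

Definition unit_segment (a e : 'rV[R]_n) : set 'rV[R]_n :=
  [set a + t *: e | t in `[0, 1]].

Definition besicovitch (K : set 'rV[R]_n) : Prop :=
  forall e, enorm e = 1 -> exists a, unit_segment a e `<=` K.

End Euclidean.

Section HausdorffDimension.
Context {R : realType} {n : nat}.
Implicit Types (s d : R) (A U : set 'rV[R]_n).
Local Open Scope ereal_scope.

(* |U|^s with |set0|^s = 0 also when s = 0; for nonempty U the library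
   convention 0 `^ 0 = 1 makes the 0-dimensional measure count points. *)
Definition diam_pow s U : \bar R :=
  if `[< U = set0 >] then 0 else ediam U `^ s.

Definition hausdorff_content s d A : \bar R :=
  ereal_inf [set \sum_(0 <= i <oo) diam_pow s (U i) | U in
    [set U : nat -> set 'rV[R]_n |
      A `<=` \bigcup_i U i /\ forall i, ediam (U i) <= d%:E]].

(* The limit as d -> 0+, which is a supremum by monotonicity in d. *)
Definition hausdorff_measure s A : \bar R :=
  ereal_sup [set hausdorff_content s d A | d in [set d | (0 < d)%R]].

Definition hausdorff_dim A : \bar R :=
  ereal_inf [set s%:E | s in
    [set s | (0 <= s)%R /\ hausdorff_measure s A = 0]].

End HausdorffDimension.

Section PackingDimension.
Context {R : realType} {n : nat}.
Implicit Types (s d : R) (A : set 'rV[R]_n).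
Local Open Scope ereal_scope.

(* A packing of A is a family of pairwise disjoint closed balls, each given as
   a pair (center, radius), with centers in A and radii in ]0, d]. *)
Definition is_packing d A (B : set ('rV[R]_n * R)) : Prop :=
  (forall b, B b -> A b.1 /\ (0 < b.2 <= d)%R) /\
  trivIset B (fun b => ecball b.1 b.2).

Definition packing_content s d A : \bar R :=
  ereal_sup [set \esum_(b in B) ((2 * b.2) `^ s)%:E | B in is_packing d A].

(* The limit as d -> 0+, which is an infimum by monotonicity in d. *)
Definition packing_premeasure s A : \bar R :=
  ereal_inf [set packing_content s d A | d in [set d | (0 < d)%R]].

Definition packing_measure s A : \bar R :=
  ereal_inf [set \sum_(0 <= i <oo) packing_premeasure s (F i) | F in
    [set F : nat -> set 'rV[R]_n | A `<=` \bigcup_i F i]].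

Definition packing_dim A : \bar R :=
  ereal_inf [set s%:E | s in
    [set s | (0 <= s)%R /\ packing_measure s A = 0]].

End PackingDimension.

(* Main.v *)
Require Import Defs.
From mathcomp Require Import all_boot all_order all_algebra.
From mathcomp Require Import all_classical all_reals all_analysis.
From mathcomp Require Import finmap ring lra.

Set Implicit Arguments.
Unset Strict Implicit.
Unset Printing Implicit Defensive.

Import Order.TTheory GRing.Theory Num.Theory.
Import numFieldNormedType.Exports.

Local Open Scope classical_set_scope.
Local Open Scope ring_scope.

(* If [x] is in the closed unit ball, a segment of [K] in the direction of [x]
   shows that [x] is a difference of two points of [K], so [K - K] contains the
   unit ball. On the other hand, suppose that [H^s K = 0], [P^t K = 0] and
   [s + t < n]. Then [K] is a countable union of sets [F i] of finite packing
   premeasure, and a maximal packing shows that [F i] is covered by at most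
   [C / r ^ t] balls of radius [2 r] for all small [r]. If sets [U j] of diameter
   at most [r j] cover [K], then [U j - F i] is covered by at most [C / r j ^ t]
   cubes of side comparable to [r j], whose total volume is comparable to
   [r j ^ (n - t)]. As [n - t > s], the sum over [j] can be made arbitrarily small,
   so [K - K] is Lebesgue null. The contradiction between these two facts needs no
   measure theory in dimension [n]: by compactness finitely many of the cubes
   cover a cube of the ball, and one compares volumes by counting grid points. *)

(** * Volumes of cubes compared by counting grid points *)

Lemma card_close_multiples (R : realType) (N : nat) (h c l : R) :
  0 < h -> 0 <= l ->
  #|[pred a : 'I_N | `|a%:R * h - c| < l]|%:R <= 2 * l / h + 1.
Proof.
move=> h0 l0; set A := [pred a : 'I_N | _].
have L0 : 0 <= 2 * l / h by apply: divr_ge0; [lra | exact: ltW].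
case: (pickP A) => [a0 Aa0|A0]; last by rewrite (eq_card0 A0); lra.
have [m Am mmin] := @arg_minnP _ a0 A (fun a : 'I_N => nat_of_ord a) Aa0.
pose k := Num.truncn (2 * l / h).
have/andP[k1 k2] := truncn_itv L0.
(* Two multiples of [h] within [l] of [c] are less than [2 * l] apart, so no index in [A] exceeds
   the least one [m] by more than [k]. *)
have sub : {subset map val (enum A) <= iota m k.+1}.
  move=> _ /mapP[a + ->]; rewrite mem_enum => Aa; rewrite mem_iota.
  have ma := mmin a Aa; rewrite ma /= addnS ltnS -leq_subLR.
  rewrite /k truncn_ge_nat // ler_pdivlMr // natrB //.
  move: Aa Am; rewrite !inE !ltr_distl => /andP[? ?] /andP[? ?]; lra.
have := uniq_leq_size _ sub; rewrite map_inj_uniq; last exact: val_inj.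
rewrite enum_uniq size_map size_iota -cardE => /(_ isT) cA.
apply: (@le_trans _ _ (k.+1)%:R); first by rewrite ler_nat.
by rewrite -natr1 lerD2r.
Qed.

Lemma card_le_sum_cover (T : finType) (I : eqType) (s : seq I)
    (P : I -> pred T) :
  (forall x, exists2 i, i \in s & P i x) -> (#|T| <= \sum_(i <- s) #|P i|)%N.
Proof.
move=> cov; rewrite -sum1_card.
under [leqRHS]eq_bigr do rewrite -sum1_card big_mkcond /=.
rewrite exchange_big /=; apply: leq_sum => x _.
have [i si Pix] := cov x.
by rewrite (big_rem i) //= [x \in _]Pix.
Qed.

(* Each cube of half side [b.2] contains at most [(4 b.2 N / h) ^ n] of the
   [N ^ n] points of a fine grid. *)
Lemma cube_cover_volume (R : realType) n (h : R) (B : seq ('rV[R]_n * R)) :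
  0 < h -> (forall b, b \in B -> 0 < b.2) ->
  (forall x : 'rV[R]_n, (forall i, 0 <= x ord0 i <= h) ->
    exists2 b, b \in B & forall i, `|x ord0 i - b.1 ord0 i| < b.2) ->
  h ^+ n <= \sum_(b <- B) (4 * b.2) ^+ n.
Proof.
move=> h0 Bpos cov.
(* [N] exceeds every [h / (2 * b.2)]. The grid step is then at most [2 * b.2], and the [+ 1] in the
   one-dimensional count is absorbed by doubling [2 * b.2] to [4 * b.2]. *)
pose N := (\sum_(b <- B) (Num.truncn (h / (2 * b.2))).+1).+1.
have Nr0 : 0 < N%:R :> R by rewrite ltr0n.
have hN b : b \in B -> h / N%:R <= 2 * b.2.
  move=> bB; have b0 := Bpos b bB.
  rewrite ler_pdivrMr // mulrC -ler_pdivrMr; last by lra.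
  apply: le_trans (ltW (truncnS_gt _)) _.
  by rewrite ler_nat /N (big_rem b) //= ltnW // ltnS leq_addr.
have g0 : 0 < h / N%:R by exact: divr_gt0.
pose P (b : 'rV[R]_n * R) := [pred f : {ffun 'I_n -> 'I_N} |
  [forall i, `|(f i)%:R * (h / N%:R) - b.1 ord0 i| < b.2]].
have cP b : b \in B -> #|P b|%:R <= (4 * b.2 / (h / N%:R)) ^+ n.
  move=> bB.
  pose Q i := [pred a : 'I_N | `|a%:R * (h / N%:R) - b.1 ord0 i| < b.2].
  have -> : #|P b| = #|(family Q : simpl_pred {ffun 'I_n -> 'I_N})|.
    by apply: eq_card => f; apply/forallP/familyP.
  rewrite card_family foldrE big_map big_enum /= natr_prod.
  rewrite -[X in _ <= _ ^+ X](card_ord n) -prodr_const.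
  apply: ler_prod => i _; rewrite ler0n /=.
  apply: le_trans (card_close_multiples _ _ g0 (ltW (Bpos b bB))) _.
  rewrite -[X in _ + X](divff (lt0r_neq0 g0)) -mulrDl ler_pM2r ?invr_gt0 //.
  by have := hN b bB; lra.
have /(_ B P) := @card_le_sum_cover {ffun 'I_n -> 'I_N} ('rV[R]_n * R)%type.
rewrite card_ffun !card_ord => /(_ _)/wrap[].
  move=> f; have [|b bB Hb] := cov (\row_i ((f i)%:R * (h / N%:R))).
    move=> i; rewrite mxE mulr_ge0 ?(ltW g0) //=.
    by rewrite mulrA ler_pdivrMr // mulrC ler_pM2l // ler_nat ltnW.
  by exists b => //; apply/forallP => i; have := Hb i; rewrite mxE.
rewrite -(ler_nat R) natrX natr_sum => H.
have {H} : N%:R ^+ n <= \sum_(b <- B) (4 * b.2 / (h / N%:R)) ^+ n :> R.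
  apply: le_trans H _; rewrite big_seq [X in _ <= X]big_seq.
  exact: ler_sum.
under eq_bigr do rewrite exprMn.
rewrite -mulr_suml exprVn ler_pdivlMr ?exprn_gt0 // -exprMn.
by rewrite mulrCA divff ?mulr1 // lt0r_neq0.
Qed.

(** By compactness of the closed cube, finitely many indices suffice; concatenating their families
    gives a finite cover. *)
Lemma cube_infinite_cover_volume (R : realType) n (h : R) (I : choiceType)
    (B : I -> seq ('rV[R]_n * R)) :
  0 < h -> (forall i b, b \in B i -> 0 < b.2) ->
  (forall x : 'rV[R]_n, (forall k, 0 <= x ord0 k <= h) ->
    exists i, exists2 b, b \in B i & forall k, `|x ord0 k - b.1 ord0 k| < b.2) ->
  exists2 D : seq I, uniq D &
    h ^+ n <= \sum_(i <- D) \sum_(b <- B i) (4 * b.2) ^+ n.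
Proof.
move=> h0 Bpos cov.
have := @rV_compact R n (fun=> `[0, h]%classic) (fun=> @segment_compact _ _ _).
rewrite compact_cover.
(* [ball] refers to the sup norm, so these are unions of open cubes. *)
pose f i : set 'rV[R]_n := \bigcup_(b in [set` B i]) ball b.1 b.2.
move=> /(_ I setT f)[||D _ Dcov].
- by move=> i _; apply: bigcup_open => b _; exact: ball_open.
- move=> x /= xQ; have [k|i [b bB Hb]] := cov x.
    by have := xQ k; rewrite /= in_itv.
  exists i => //; exists b => //; split; first exact: Bpos bB.
  by move=> j k; rewrite ord1 /ball /= distrC.
exists (D : seq I); first exact: fset_uniq.
pose E := flatten [seq B i | i <- (D : seq I)].
have -> : \sum_(i <- D) \sum_(b <- B i) (4 * b.2) ^+ n =
    \sum_(b <- E) (4 * b.2) ^+ n by rewrite big_flatten big_map.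
apply: cube_cover_volume => // [b /flatten_mapP[i _]|x xQ].
  exact: Bpos.
have [|i /= iD [b /= bB [_ Hb]]] := Dcov x.
  by move=> k; rewrite /= in_itv /= xQ.
exists b; first by apply/flatten_mapP; exists i.
by move=> k; rewrite distrC; exact: Hb.
Qed.

(** * From packings to coverings *)

Lemma normr_coord_le_enorm (R : realType) n (x : 'rV[R]_n) i :
  `|x ord0 i| <= enorm x.
Proof.
rewrite -sqrtr_sqr ler_sqrt; last by apply: sumr_ge0 => j _; exact: sqr_ge0.
by rewrite (bigD1 i) //= lerDl; apply: sumr_ge0 => j _; exact: sqr_ge0.
Qed.

(** Turns a bound on the packing content into a bound on the number of disjoint balls of one common
    radius. *)
Lemma packing_content_ge (R : realType) n (t d r : R) (F : set 'rV[R]_n)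
    (s : seq 'rV[R]_n) :
  0 < r <= d -> uniq s -> {in s, forall x, F x} ->
  {in s &, forall x y, ecball x r `&` ecball y r !=set0 -> x = y} ->
  (((size s)%:R * (2 * r) `^ t)%:E <= packing_content t d F)%E.
Proof.
move=> rd us sF sep; pose B := [seq (x, r) | x <- s].
have uB : uniq B by rewrite map_inj_uniq // => x y [].
apply: (@le_trans _ _ (\esum_(b in [set` B]) ((2 * b.2) `^ t)%:E)%E); last first.
  apply: ereal_sup_ubound; exists [set` B] => //; split => /=.
    by move=> _ /mapP[x xs ->] /=; split => //; exact: sF.
  move=> _ _ /mapP[x xs ->] /mapP[y ys ->] /= m.
  by rewrite (sep x y).
apply: esum_ge; exists [set` B]; first by split => //; exact: finite_seq.
rewrite -fsbig_seq // big_map /= sumEFin lee_fin.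
by rewrite big_const_seq count_predT iter_addr_0 mulr_natl.
Qed.

(** Once the content at scale [d] is finite, it bounds the size of packings by [r]-balls for every
    [r <= d], so [C] does not depend on [r]. In a packing of maximal size, the [r]-ball around any
    point of [F] meets a chosen ball. *)
Lemma finite_premeasure_cover (R : realType) n (t : R) (F : set 'rV[R]_n) :
  0 <= t -> (packing_premeasure t F < +oo)%E ->
  exists d C : R, [/\ 0 < d, 0 < C & forall r, 0 < r <= d ->
    exists2 s : seq 'rV[R]_n, (size s)%:R * r `^ t <= C &
      forall x, F x -> exists2 y, y \in s &
        forall i, `|x ord0 i - y ord0 i| <= 2 * r].
Proof.
move=> t0 /ereal_inf_lt[_ [d /= d0 <-] fin]; exists d.
pose M := fine (packing_content t d F).
have M0 : (0 <= packing_content t d F)%E.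
  apply: ereal_sup_ubound; exists set0; last by rewrite esum_set0.
  by split=> // b c [].
have ME : packing_content t d F = M%:E.
  by rewrite fineK // ge0_fin_numE.
have {}M0 : 0 <= M by rewrite -lee_fin -ME.
(* [M] itself may be zero. *)
exists (M + 1); split=> //; first by lra.
move=> r /andP[r0 rd].
pose Q (s : seq 'rV[R]_n) := [/\ uniq s, {in s, forall x, F x} &
  {in s &, forall x y, ecball x r `&` ecball y r !=set0 -> x = y}].
pose P N := `[< exists2 s, Q s & size s = N >].
have Qb s : Q s -> (size s)%:R * (2 * r) `^ t <= M.
  move=> [us sF sep]; rewrite -lee_fin -ME.
  by apply: packing_content_ge => //; rewrite r0.
have P0 : exists N, P N by exists 0%N; apply/asboolP; exists [::].
have p0 : 0 < (2 * r) `^ t by apply: powR_gt0; lra.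
have Pb N : P N -> (N <= Num.truncn (M / (2 * r) `^ t))%N.
  move=> /asboolP[s Qs <-].
  rewrite truncn_ge_nat; last by rewrite divr_ge0 // ltW.
  by rewrite ler_pdivlMr //; exact: Qb.
case: (ex_maxnP P0 Pb) => N /asboolP[s Qs sN] maxN.
exists s.
  apply: (@le_trans _ _ M); last by lra.
  apply: le_trans (Qb s Qs); apply: ler_wpM2l => //.
  by apply: ge0_ler_powR => //; rewrite ?nnegrE; lra.
move=> x Fx; apply: contrapT => far.
have xs y : y \in s -> ~ (ecball x r `&` ecball y r !=set0).
  move=> ys [z [zx zy]]; apply: far; exists y => // i.
  have := normr_coord_le_enorm (z - x) i; have := normr_coord_le_enorm (z - y) i.
  move: zx zy; rewrite /ecball /= !mxE => ? ? ? ?.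
  rewrite (_ : _ - _ = (z ord0 i - y ord0 i) - (z ord0 i - x ord0 i)); last by ring.
  by apply: le_trans (ler_normB _ _) _; lra.
have : P N.+1.
  apply/asboolP; exists (x :: s); last by rewrite /= sN.
  case: Qs => us sF sep.
  have rx (z : 'rV[R]_n) : ecball z r z.
    rewrite /ecball /= subrr /enorm big1 ?sqrtr0 ?ltW // => i _.
    by rewrite mxE expr0n.
  split.
  - rewrite /= us andbT; apply/negP => xis.
    by apply: (xs x xis); exists x; split; exact: rx.
  - by move=> y; rewrite inE => /predU1P[->//|]; exact: sF.
  - move=> y z; rewrite !inE => /predU1P[->|ys] /predU1P[->|zs] //.
    + by move=> /(xs _ zs).
    + by rewrite setIC => /(xs _ ys).
    + exact: sep.
by move=> /maxN; rewrite ltnn.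
Qed.

(** * Finite sums of nonnegative terms *)

Lemma ler_sum_subset (R : numDomainType) (I : eqType) (s1 s2 : seq I)
    (f : I -> R) :
  (forall i, 0 <= f i) -> uniq s1 -> {subset s1 <= s2} ->
  \sum_(i <- s1) f i <= \sum_(i <- s2) f i.
Proof.
move=> f0; elim: s1 s2 => [|a s1 IH] s2 /=.
  by move=> _ _; rewrite big_nil; apply: sumr_ge0.
move=> /andP[as1 us1] sub; have as2 : a \in s2 by apply: sub; rewrite mem_head.
rewrite big_cons (big_rem a as2) /= lerD2l; apply: IH => // x xs1.
have := perm_mem (perm_to_rem as2) x.
rewrite sub ?inE ?xs1 ?orbT // => /esym /predU1P[xa|//].
by rewrite -xa xs1 in as1.
Qed.

Lemma subset_iota (J : seq nat) : exists m, {subset J <= iota 0 m}.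
Proof.
exists (\sum_(j <- J) j.+1)%N => j jJ.
by rewrite mem_iota /= add0n (big_rem j) //= addSn ltnS leq_addr.
Qed.

(** These weights split an error among countably many pieces. *)
Lemma sum_half_powers_le1 (R : realFieldType) (J : seq nat) :
  uniq J -> \sum_(j <- J) (2^-1 : R) ^+ j.+1 <= 1.
Proof.
move=> uJ; have [m Jm] := subset_iota J.
have p0 j : 0 <= (2^-1 : R) ^+ j by rewrite exprn_ge0 // invr_ge0.
apply: le_trans (ler_sum_subset (fun=> p0 _) uJ Jm) _.
suff -> : \sum_(j <- iota 0 m) (2^-1 : R) ^+ j.+1 = 1 - 2^-1 ^+ m.
  by rewrite gerBl.
have -> : iota 0 m = index_iota 0 m by rewrite /index_iota subn0.
elim: m {Jm} => [|m IH]; first by rewrite big_geq // expr0 subrr.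
by rewrite big_nat_recr //= IH exprS; field.
Qed.

(** * Differences of points of a Besicovitch set *)

Lemma enormZ (R : realType) n (c : R) (x : 'rV[R]_n) :
  enorm (c *: x) = `|c| * enorm x.
Proof.
rewrite /enorm -sqrtr_sqr -sqrtrM ?sqr_ge0 // mulr_sumr.
by under eq_bigr do rewrite mxE exprMn.
Qed.

Lemma enorm_eq0 (R : realType) n (x : 'rV[R]_n) : enorm x = 0 -> x = 0.
Proof.
move=> x0; apply/rowP => i; rewrite mxE; apply/eqP.
by rewrite -normr_le0 -x0 normr_coord_le_enorm.
Qed.

Lemma besicovitch_sub (R : realType) n (K : set 'rV[R]_n) (x : 'rV[R]_n) :
  (0 < n)%N -> besicovitch K -> enorm x <= 1 ->
  exists u v, [/\ K u, K v & x = u - v].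
Proof.
move=> n0 BK x1.
have [e e1 xe] : exists2 e : 'rV[R]_n, enorm e = 1 & x = enorm x *: e.
  have [x0|x0] := eqVneq (enorm x) 0.
    (* For [x = 0] any unit vector serves as the direction. *)
    exists (delta_mx 0 (Ordinal n0)); last by rewrite x0 scale0r (enorm_eq0 x0).
    rewrite /enorm (bigD1 (Ordinal n0)) //= big1 => [|i /negPf ni].
      by rewrite !mxE !eqxx expr1n addr0 sqrtr1.
    by rewrite !mxE ni andbF expr0n.
  exists ((enorm x)^-1 *: x); last by rewrite scalerA divff // scale1r.
  by rewrite enormZ normfV ger0_norm ?sqrtr_ge0 // mulVf.
have [a aK] := BK e e1; exists (a + enorm x *: e), a; split.
- by apply: aK; exists (enorm x) => //; rewrite /= in_itv /= sqrtr_ge0.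
- apply: aK; exists 0; last by rewrite scale0r addr0.
  by rewrite /= in_itv /= lexx ler01.
- by rewrite addrC addKr.
Qed.

(** * Efficient covers of sets of Hausdorff measure zero *)

Lemma hausdorff_null_cover (R : realType) n (s s' d eps : R)
    (A : set 'rV[R]_n) :
  0 <= s < s' -> 0 < d <= 1 -> 0 < eps -> hausdorff_measure s A = 0%E ->
  exists (U : nat -> set 'rV[R]_n) (r : nat -> R),
    [/\ A `<=` \bigcup_j U j, forall j, 0 < r j <= d,
        forall j x y, U j x -> U j y -> enorm (x - y) <= r j &
        forall J, uniq J -> \sum_(j <- J) r j `^ s' <= eps].
Proof.
move=> /andP[s0 ss'] /andP[d0 d1] e0 Hs.
have s'0 : 0 < s' by exact: le_lt_trans s0 ss'.
have : (hausdorff_content s d A < (eps / 2)%:E)%E.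
  apply: (@le_lt_trans _ _ 0%E); last by rewrite lte_fin; lra.
  by rewrite -Hs; apply: ereal_sup_ubound; exists d.
move=> /ereal_inf_lt[_ [U [AU Ud] <-] sumU].
pose u j := fine (ediam (U j)).
have uE j : ediam (U j) = (u j)%:E.
  rewrite fineK // ge0_fin_numE ?(le_lt_trans (Ud j)) ?ltry //.
  by rewrite /ediam le_max lexx.
have u0 j : 0 <= u j by rewrite -lee_fin -uE /ediam le_max lexx.
have ud j : u j <= d by rewrite -lee_fin -uE.
have udiam j x y : U j x -> U j y -> enorm (x - y) <= u j.
  move=> Ux Uy; rewrite -lee_fin -uE /ediam le_max; apply/orP; right.
  by apply: ereal_sup_ubound; exists x => //; exists y.
have diam0 j : (0 <= diam_pow s (U j))%E.
  by rewrite /diam_pow; case: ifP => // _; exact: poweR_ge0.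
(* Raising the exponent is harmless as [u j <= d <= 1]. Since [s' > 0] even when [s = 0], pieces of
   diameter zero cost nothing at exponent [s']. *)
have upow j : ((u j `^ s')%:E <= diam_pow s (U j))%E.
  have [uj0|uj0] := eqVneq (u j) 0.
    by rewrite uj0 powR0 ?gt_eqF.
  rewrite /diam_pow; case: asboolP => [Uj0|_].
    case/eqP: uj0; rewrite /u /ediam Uj0.
    rewrite (_ : [set _ | _ in _ & _ in _] = set0) ?ereal_sup0 ?maxEge ?leNye //.
    by apply/seteqP; split => // z [? []].
  rewrite uE poweR_EFin lee_fin ger_powR ?(ltW ss') //.
  by rewrite lt0r uj0 u0 (le_trans (ud j)).
(* Pieces of diameter [0] still need a positive radius, at total cost [eps / 2]. *)
pose w j := eps / 2 * 2^-1 ^+ j.+1.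
have w0 j : 0 < w j by rewrite mulr_gt0 ?exprn_gt0 ?invr_gt0 //; lra.
pose rho j := Num.min d (w j `^ s'^-1).
have rho0 j : 0 < rho j by rewrite lt_min d0 powR_gt0.
exists U, (fun j => Num.max (u j) (rho j)); split => //.
- by move=> j; rewrite lt_max rho0 orbT ge_max ud ge_min lexx.
- by move=> j x y Ux Uy; rewrite le_max (udiam j).
move=> J uJ; apply: (@le_trans _ _ (\sum_(j <- J) (u j `^ s' + w j))).
  apply: ler_sum => j _; rewrite maxEle; case: ifP => _; last first.
    by rewrite lerDl ltW.
  apply: (@le_trans _ _ (w j)); last by rewrite lerDr powR_ge0.
  have -> : w j = (w j `^ s'^-1) `^ s'.
    by rewrite -powRrM mulVf ?gt_eqF // powRr1 // ltW.
  by apply: ge0_ler_powR; rewrite ?nnegrE ?powR_ge0 ?ge_min ?lexx ?orbT ?ltW.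
rewrite big_split /= -mulr_sumr [leRHS]splitr; apply: lerD; last first.
  by rewrite ger_pMr ?sum_half_powers_le1 //; lra.
have [m Jm] := subset_iota J.
apply: le_trans (ler_sum_subset (fun=> powR_ge0 _ _) uJ Jm) _.
rewrite -lee_fin; apply: le_trans (ltW sumU).
apply: le_trans (nneseries_lim_ge m (fun j _ _ => diam0 j)).
by rewrite -sumEFin /index_iota subn0; apply: lee_sum.
Qed.

(** * Contradiction from null exponents with [s + t < n] *)

Lemma null_exponents_add_ge (R : realType) n (K : set 'rV[R]_n) (s t : R) :
  (0 < n)%N -> besicovitch K -> 0 <= s -> 0 <= t ->
  hausdorff_measure s K = 0%E -> packing_measure t K = 0%E -> n%:R <= s + t.
Proof.
move=> n0 BK s0 t0 Hs Pt; rewrite leNgt; apply/negP => stn.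
have nr0 : 0 < n%:R :> R by rewrite ltr0n.
have : (packing_measure t K < 1)%E by rewrite Pt lte_fin.
move=> /ereal_inf_lt[_ [F KF <-] sumF].
have premeasure_ge0 (A : set 'rV[R]_n) : (0 <= packing_premeasure t A)%E.
  apply: le_ereal_inf_tmp => _ [d _ <-].
  apply: ereal_sup_ubound; exists set0; last by rewrite esum_set0.
  by split=> // b c [].
have Ffin i : (packing_premeasure t (F i) < +oo)%E.
  apply: le_lt_trans (lt_trans sumF (ltry 1)).
  have := @nneseries_lim_ge R (fun j => packing_premeasure t (F j)) xpredT 0 i.+1
    (fun j _ _ => premeasure_ge0 (F j)).
  apply: le_trans.
  by rewrite big_nat_recr //= leeDr // sume_ge0.
have /choice[d /choice[C dC]] i := finite_premeasure_cover t0 (Ffin i).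
(* The cube of side [1 / n] at the origin lies in the unit ball: [n * h ^+ 2 <= n * h = 1]. *)
pose h : R := n%:R^-1; have h0 : 0 < h by rewrite invr_gt0.
(* Chosen so that piece [i] contributes volume at most [h ^+ n / 2 * 2^-1 ^+ i.+1], hence
   [h ^+ n / 2] in total. *)
pose eps i : R := h ^+ n / 2 / (16 ^+ n * C i) * 2^-1 ^+ i.+1.
have eps0 i : 0 < eps i.
  have [_ Ci _] := dC i.
  by rewrite /eps !(mulr_gt0, divr_gt0, invr_gt0, exprn_gt0).
have st : 0 <= s < n%:R - t by rewrite s0; lra.
have d0 i : 0 < Num.min (d i) 1 <= 1.
  by have [di _ _] := dC i; rewrite lt_min di ltr01 ge_min lexx orbT.
(* Each [F i] gets its own cover of all of [K], because the admissible scale [d i] and the constant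
   [C i] vary with [i]. *)
have /choice[U /choice[r Ur]] i := hausdorff_null_cover st (d0 i) (eps0 i) Hs.
have r0 i j : 0 < r i j by have [_ /(_ j)/andP[]] := Ur i.
have /choice[S HS] (p : nat * nat) : exists S : seq 'rV[R]_n,
    (size S)%:R * r p.1 p.2 `^ t <= C p.1 /\
    forall x, F p.1 x -> exists2 y, y \in S &
        forall i, `|x ord0 i - y ord0 i| <= 2 * r p.1 p.2.
  have [_ /(_ p.2)/andP[_ rd] _ _] := Ur p.1; have [_ _] := dC p.1.
  case/(_ (r p.1 p.2)) => [|S S1 S2]; last by exists S.
  by rewrite r0 (le_trans rd) // ge_min lexx.
(* These cubes cover the differences [U i j - F i]. The point chosen in [U i j] is off by at most
   [r], the net point [y] by at most [2 * r]; half side [4 * r] makes the inequality strict. *)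
pose B (p : nat * nat) :=
  [seq (xget 0 (U p.1 p.2) - y, 4 * r p.1 p.2) | y <- S p].
have [||D uD] := @cube_infinite_cover_volume R n h (nat * nat)%type B h0.
- by move=> p _ /mapP[y _ ->] /=; rewrite mulr_gt0.
- move=> x xh; have x1 : enorm x <= 1.
    rewrite /enorm -sqrtr1; apply: ler_wsqrtr.
    apply: (@le_trans _ _ (\sum_(i < n) h)); last first.
      by rewrite sumr_const card_ord -[h *+ n]mulr_natl divff ?gt_eqF.
    apply: ler_sum => i _; have /andP[x0 xi] := xh i.
    rewrite expr2; apply: le_trans (ler_pM x0 x0 xi xi) _.
    by rewrite ger_pMr // /h invf_le1 // ler1n.
  have [a [b [Ka Kb ->]]] := besicovitch_sub n0 BK x1.
  have [i _ Fb] := KF _ Kb.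
  have [/(_ _ Ka)[j _ Ua] _ Udiam _] := Ur i.
  have [_ /(_ _ Fb)[y yS yb]] := HS (i, j).
  exists (i, j), (xget 0 (U i j) - y, 4 * r i j); first exact: map_f.
  move=> k; rewrite !mxE /=.
  have := Udiam j _ _ Ua (xgetPex 0 (ex_intro _ _ Ua)).
  have := normr_coord_le_enorm (a - xget 0 (U i j)) k; rewrite !mxE.
  have := yb k; have := r0 i j => /= rij yk ax axr.
  rewrite (_ : _ - _ = (a ord0 k - xget 0 (U i j) ord0 k) -
    (b ord0 k - y ord0 k)); last by ring.
  by apply: le_lt_trans (ler_normB _ _) _; lra.
apply/negP; rewrite -ltNge.
have C0 i : 0 < C i by have [] := dC i.
pose I := undup (map fst D); pose J := undup (map snd D).
(* At most [C / r ^ t] cubes, each counted as [(4 * (4 * r)) ^+ n]. *)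
pose g (p : nat * nat) := 16 ^+ n * C p.1 * r p.1 p.2 `^ (n%:R - t).
apply: (@le_lt_trans _ _ (\sum_(p <- D) g p)).
  apply: ler_sum => p _; rewrite big_map /= big_const_seq count_predT iter_addr_0.
  rewrite -[_ *+ size _]mulr_natl (_ : 4 * (4 * _) = 16 * r p.1 p.2); last by ring.
  rewrite exprMn /g mulrCA -!mulrA.
  apply: ler_wpM2l; first exact: exprn_ge0.
  have rp := r0 p.1 p.2; have [Sp _] := HS p.
  have -> : r p.1 p.2 ^+ n = r p.1 p.2 `^ t * r p.1 p.2 `^ (n%:R - t).
    rewrite -powRD ?(gt_eqF rp) ?implybT //.
    by rewrite [t + _]addrC subrK powR_mulrn // ltW.
  by rewrite mulrA; apply: ler_wpM2r => //; exact: powR_ge0.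
have g0 p : 0 <= g p by rewrite !mulr_ge0 ?powR_ge0 ?exprn_ge0 ?(ltW (C0 _)).
(* Enlarging [D] to a rectangle allows summing over [j] first, with [i] fixed. *)
have /(ler_sum_subset g0 uD) : {subset D <= [seq (i, j) | i <- I, j <- J]}.
  move=> [i j] ij; apply/allpairsP; exists (i, j).
  by rewrite !mem_undup; split=> //; apply/mapP; exists (i, j).
move=> /le_lt_trans; apply; rewrite big_allpairs.
apply: (@le_lt_trans _ _ (\sum_(i <- I) (h ^+ n / 2 * 2^-1 ^+ i.+1))).
  apply: ler_sum => i _; rewrite /g /= -mulr_sumr.
  have [_ _ _ /(_ J (undup_uniq _)) Ji] := Ur i.
  have Ci : 0 < 16 ^+ n * C i by rewrite mulr_gt0 ?exprn_gt0.
  apply: le_trans (ler_wpM2l (ltW Ci) Ji) _.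
  by rewrite /eps mulrA mulrCA divff ?mulr1 // gt_eqF.
rewrite -mulr_sumr; have hn0 : 0 < h ^+ n by exact: exprn_gt0.
have := sum_half_powers_le1 R (undup_uniq (map fst D)); rewrite -/I => I1.
by apply: (@le_lt_trans _ _ (h ^+ n / 2)); [rewrite ger_pMr|]; lra.
Qed.

Theorem corollary1p10 (R : realType) (n : nat) (hn : (2 <= n)%N)
    (K : set 'rV[R]_n) (hK : besicovitch K) :
  (n%:R%:E <= hausdorff_dim K + packing_dim K)%E.
Proof.
have n0 : (0 < n)%N by exact: ltnW.
have P0 : (0 <= packing_dim K)%E.
  by apply: le_ereal_inf_tmp => _ [t [t0 _] <-]; rewrite lee_fin.
have H0 : (0 <= hausdorff_dim K)%E.
  by apply: le_ereal_inf_tmp => _ [s [s0 _] <-]; rewrite lee_fin.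
have Hle t : 0 <= t -> packing_measure t K = 0%E ->
    ((n%:R - t)%:E <= hausdorff_dim K)%E.
  move=> t0 Pt; apply: le_ereal_inf_tmp => _ [s [s0 Hs] <-].
  by rewrite lee_fin lerBlDr; exact: null_exponents_add_ge Hs Pt.
(* A real value of [hausdorff_dim K] can be moved across the inequality, leaving an infimum over
   [t]; the value [+oo] is treated apart. *)
move: H0 Hle; case: (hausdorff_dim K) => [x||] // x0 Hle; last first.
  by rewrite addye ?leey // gt_eqF // (lt_le_trans _ P0) ?ltNy0.
rewrite addeC -leeBlDr //; apply: le_ereal_inf_tmp => _ [t [t0 Pt] <-].
by have := Hle t t0 Pt; rewrite -EFinB !lee_fin; lra.
Qed.
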